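(* Let $\widehat{A}=A+\varepsilon B$ be an $n\times n$ symmetric dual matrix (i.e. $\widehat{A}^{T}=\widehat{A}$) with $A,B\in\mathbb{R}^{n\times n}$, and suppose its dual core generalized inverse $\widehat{A}^{\mathrm{c}}$ exists. Then $$\widehat{A}^{\mathrm{c}}=(\widehat{A}^{\mathrm{c}})^{T}=A^{\mathrm{c}}+\varepsilon\left(-A^{\mathrm{c}}BA^{\mathrm{c}}+(A^{\mathrm{c}})^{2}B(I_n-AA^{\mathrm{c}})+(I_n-AA^{\mathrm{c}})B(A^{\mathrm{c}})^{2}\right),$$ where $A^{\mathrm{c}}$ is the core inverse of the real matrix $A$.
   Context: Dual numbers are $a+\varepsilon a'$ with $a,a'\in\mathbb{R}$ and $\varepsilon\neq 0$, $\varepsilon^2=0$ (i.e. the ring $\mathbb{R}[\varepsilon]/(\varepsilon^2)$). A dual matrix is a matrix over dual numbers, written $\widehat{A}=A+\varepsilon B$ with $A,B$ real; its transpose is $\widehat{A}^{T}=A^{T}+\varepsilon B^{T}$. The dual core generalized inverse (DCGI) $\widehat{A}^{\mathrm{c}}$ of an $n\times n$ dual matrix $\widehat{A}$ is the (unique, if it exists) dual matrix $\widehat{G}$ with $\widehat{A}\widehat{G}\widehat{A}=\widehat{A}$, $\widehat{A}\widehat{G}^2=\widehat{G}$, $(\widehat{A}\widehat{G})^{T}=\widehat{A}\widehat{G}$. For a real square matrix $A$ with $\mathrm{rank}(A^2)=\mathrm{rank}(A)$ the core inverse $A^{\mathrm{c}}$ is the unique real $X$ with $AXA=A$, $AX^2=X$,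 $(AX)^{T}=AX$. *)

(* Defs.v *)
From mathcomp Require Import all_boot all_order all_algebra reals.

Set Implicit Arguments.
Unset Strict Implicit.
Unset Printing Implicit Defensive.

Import GRing.Theory.
Local Open Scope ring_scope.

Notation dual R := {poly %/ ('X^2 : {poly R})}.

Definition dual_eps (R : comNzRingType) : dual R := 'qX.

(* A + eps B *)
Definition dual_mx (R : comNzRingType) (m n : nat) (A B : 'M[R]_(m, n)) :
    'M[dual R]_(m, n) :=
  map_mx (qpolyC 'X^2) A + dual_eps R *: map_mx (qpolyC 'X^2) B.

(* Stated over an arbitrary ring because the dual core generalized inverse and
   the real core inverse are defined by the same equations. *)
Definition core_equations (R : comNzRingType) (n : nat) (A X : 'M[R]_n) : Prop :=
  [/\ A *m X *m A = A, A *m (X *m X) = X & (A *m X)^T = A *m X].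

Definition is_dcgi (R : comNzRingType) (n : nat) (A G : 'M[dual R]_n) : Prop :=
  core_equations A G.

Definition is_core_inverse (R : fieldType) (n : nat) (A X : 'M[R]_n) : Prop :=
  \rank (A *m A) = \rank A /\ core_equations A X.

Lemma dual_eps_neq0 (R : comNzRingType) : dual_eps R != 0.
Proof.
apply/eqP => /(congr1 (fun p : dual R => (p : {poly R}))).
rewrite /dual_eps qpolyXE ?size_polyXn ?monicXn //= => /eqP.
by rewrite polyX_eq0.
Qed.

Lemma dual_eps_sqr (R : comNzRingType) : dual_eps R ^+ 2 = 0.
Proof.
apply: val_inj; rewrite /dual_eps -rmorphXn /= mk_monic_Xn.
exact: Pdiv.RingMonic.rmodpp (monicXn _ _).
Qed.

(* Main.v *)
Require Import Defs.
From mathcomp Require Import all_boot all_order all_algebra reals.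

Import GRing.Theory.
Local Open Scope ring_scope.

(** For a symmetric matrix over any commutative ring the core equations force
    the solution to be symmetric and to commute with the matrix, so that it is
    the group inverse.  Applied over the dual numbers, this gives the symmetry of
    [G = X + eps Y] and the equations [AG = GA] and [G = GAG], whose eps-parts
    read, with [P = AX = XA] and [Q = 1 - P],
      [AY + BX = YA + XB]  and  [Y = YP + XBX + PY].
    The second gives [Y = - XBX + YQ + QY], [YQ = PYQ] and [QY = QYP]; the first,
    multiplied by [X] on one side and by [Q] on the other, gives [PYQ = XXBQ] and
    [QYP = QBXX]. *)

(** Transposing [A *m X] gives [X^T *m A = A *m X], so [X = A *m X *m X = X^T *m A *m X], which is
    visibly symmetric. *)
Lemma core_sym {R : comNzRingType} {n : nat} {A X : 'M[R]_n} :
  A^T = A -> core_equations A X -> X^T = X.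
Proof.
move=> sA [_ AX2 sAX].
have XA : X^T *m A = A *m X by rewrite -sAX trmx_mul sA.
have XAX : X^T *m A *m X = X by rewrite XA -mulmxA AX2.
by rewrite -[in LHS]XAX !trmx_mul trmxK sA mulmxA XAX.
Qed.

Lemma core_comm {R : comNzRingType} {n : nat} {A X : 'M[R]_n} :
  A^T = A -> core_equations A X -> X *m A = A *m X.
Proof.
move=> sA cAX; have sX := core_sym sA cAX.
by case: cAX => _ _ <-; rewrite trmx_mul sA sX.
Qed.

Lemma core_outer {R : comNzRingType} {n : nat} {A X : 'M[R]_n} :
  A^T = A -> core_equations A X -> X *m A *m X = X.
Proof.
by move=> sA cAX; rewrite (core_comm sA cAX) -mulmxA; case: cAX.
Qed.

(** By commutation, [X *m A] and [Y *m A] both equal [X *m A *m Y *m A]; then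
    [X = XAX = YAY = Y]. *)
Lemma core_uniq {R : comNzRingType} {n : nat} {A X Y : 'M[R]_n} :
  A^T = A -> core_equations A X -> core_equations A Y -> X = Y.
Proof.
move=> sA cX cY.
have XA := core_comm sA cX; have YA := core_comm sA cY.
have [AXA _ _] := cX; have [AYA _ _] := cY.
have eXY : X *m A = Y *m A.
  by rewrite -[in LHS]AYA -(mulmxA A) YA !mulmxA XA AXA.
rewrite -(core_outer sA cX) eXY -mulmxA -XA eXY mulmxA.
by rewrite -[RHS](core_outer sA cY) -!mulmxA YA.
Qed.

Lemma core_rank {F : fieldType} {n : nat} {A X : 'M[F]_n} :
  core_equations A X -> \rank (A *m A) = \rank A.
Proof.
case=> AXA AX2 _; apply/eqP; rewrite eqn_leq mxrankM_maxl /=.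
(* Putting [A *m (X *m X)] for [X] in [A *m X *m A] exhibits [A] as a right multiple of [A *m A]. *)
rewrite -[X in (\rank X <= _)%N]AXA -[in X in (\rank X <= _)%N]AX2 !mulmxA.
rewrite -[_ *m X *m A]mulmxA -[A *m A *m X *m _]mulmxA.
exact: mxrankM_maxl.
Qed.

Lemma dual_coef {R : comNzRingType} (a b : R) :
  qpolyC 'X^2 a + dual_eps R * qpolyC 'X^2 b = a%:P + b *: 'X :> {poly R}.
Proof.
rewrite poly_of_qpolyD poly_of_qpolyM qpolyXE ?size_polyXn ?monicXn //=.
(* [b *: 'X] has degree at most 1, so reduction modulo ['X^2] fixes it. *)
rewrite mulrC mul_polyC mk_monic_Xn Pdiv.CommonRing.rmodp_small //.
by rewrite size_polyXn (leq_ltn_trans (size_scale_leq _ _)) ?size_polyX.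
Qed.

Lemma dual_mxE {R : comNzRingType} {m n : nat} (A B : 'M[R]_(m, n)) i j :
  dual_mx A B i j = (A i j)%:P + B i j *: 'X :> {poly R}.
Proof. by rewrite !mxE dual_coef. Qed.

Lemma dual_mx_inj {R : comNzRingType} {m n : nat} {A B A' B' : 'M[R]_(m, n)} :
  dual_mx A B = dual_mx A' B' -> A = A' /\ B = B'.
Proof.
move=> e; have coefE i j k := congr1 (fun M : 'M[dual R]_(m, n) =>
  (M i j : {poly R})`_k) e.
split; apply/matrixP=> i j.
  have := coefE i j 0%N.
  by rewrite !dual_mxE !coefD !coefZ !coefX !coefC /= !mulr0 !addr0.
have := coefE i j 1%N.
by rewrite !dual_mxE !coefD !coefZ !coefX !coefC /= !mulr1 !add0r.
Qed.

Lemma dual_mx_decomp {R : comNzRingType} {m n : nat} (M : 'M[dual R]_(m, n)) :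
  exists A B, M = dual_mx A B.
Proof.
exists (\matrix_(i, j) (M i j : {poly R})`_0).
exists (\matrix_(i, j) (M i j : {poly R})`_1).
apply/matrixP=> i j; apply: val_inj; rewrite [RHS]dual_mxE !mxE.
apply/polyP=> k; rewrite coefD coefZ coefX coefC.
case: k => [|[|k]] /=; rewrite ?mulr0 ?addr0 ?mulr1 ?add0r //.
(* Representatives modulo ['X^2] have size at most 2, so the coefficient at [k.+2] is 0. *)
rewrite nth_default // -ltnS (leq_trans (size_mk_monic _)) //.
by rewrite mk_monic_Xn size_polyXn.
Qed.

Lemma dual_mx_tr {R : comNzRingType} {m n : nat} (A B : 'M[R]_(m, n)) :
  (dual_mx A B)^T = dual_mx A^T B^T.
Proof. by apply/matrixP=> i j; rewrite !mxE. Qed.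

Lemma dual_mx_mul {R : comNzRingType} {m n p : nat} (A B : 'M[R]_(m, n))
    (C D : 'M[R]_(n, p)) :
  dual_mx A B *m dual_mx C D = dual_mx (A *m C) (A *m D + B *m C).
Proof.
rewrite /dual_mx mulmxDl !mulmxDr -!scalemxAl -!scalemxAr scalerA.
rewrite -expr2 dual_eps_sqr scale0r addr0 map_mxD !map_mxM scalerDr.
by rewrite !addrA.
Qed.

Lemma dual_core_eps {R : comNzRingType} {n : nat} {A B X Y : 'M[R]_n} :
    X *m A = A *m X -> A *m X *m A = A -> X *m A *m X = X ->
    A *m Y + B *m X = Y *m A + X *m B ->
    Y = Y *m (A *m X) + X *m B *m X + A *m X *m Y ->
  Y = - (X *m B *m X) + X *m X *m B *m (1%:M - A *m X)
      + (1%:M - A *m X) *m B *m (X *m X).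
Proof.
move=> XA AXA XAX eC eY; set P := A *m X in eY *.
move defQ: (1%:M - P) => Q.
have XP : X *m P = X by rewrite mulmxA.
have PX : P *m X = X by rewrite /P -XA.
have AP : A *m P = A by rewrite /P -XA mulmxA.
have XQ : X *m Q = 0 by rewrite -defQ mulmxBr mulmx1 XP subrr.
have QX : Q *m X = 0 by rewrite -defQ mulmxBl mul1mx PX subrr.
have AQ : A *m Q = 0 by rewrite -defQ mulmxBr mulmx1 AP subrr.
have QA : Q *m A = 0 by rewrite -defQ mulmxBl mul1mx AXA subrr.
have YQ : Y *m Q = X *m X *m B *m Q.
  (* [X *m Q = 0] kills the terms of [eY] ending in [X], leaving [P *m Y *m Q]. *)
  rewrite [in LHS]eY !mulmxDl -!mulmxA XQ !mulmx0 !add0r.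
  have := congr1 (fun M => X *m M *m Q) eC.
  rewrite !mulmxDr !mulmxDl -!mulmxA XQ AQ !mulmx0 addr0 add0r => <-.
  by rewrite !mulmxA XA.
have QY : Q *m Y = Q *m B *m (X *m X).
  rewrite [in LHS]eY !mulmxDr !mulmxA QX QA !mul0mx !addr0.
  have := congr1 (fun M => Q *m M *m X) eC.
  by rewrite !mulmxDr !mulmxDl !mulmxA QX QA !mul0mx addr0 add0r => ->.
(* The closed form becomes [- XBX + YQ + QY], which collapses to [Y] once [Q] is expanded as
   [1 - P]. *)
rewrite -YQ -QY -defQ mulmxBr mulmxBl mulmx1 mul1mx.
have eXBX : X *m B *m X = Y - Y *m P - P *m Y.
  by rewrite {1}eY addrAC addrK addrAC subrr add0r.
by rewrite eXBX opprB subrK addrC subrK.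
Qed.

Theorem theorem3p16 (R : realType) (n : nat) (A B : 'M[R]_n)
    (G : 'M[dual R]_n)
    (symA : (dual_mx A B)^T = dual_mx A B)
    (dcgiG : is_dcgi (dual_mx A B) G) :
  exists Ac : 'M[R]_n,
    [/\ unique (is_core_inverse A) Ac,
        G = G^T
      & G^T = dual_mx Ac
          (- (Ac *m B *m Ac)
           + Ac *m Ac *m B *m (1%:M - A *m Ac)
           + (1%:M - A *m Ac) *m B *m (Ac *m Ac))].
Proof.
(* With [G^T] replaced by [G], only the formula for [G] itself remains to be found. *)
rewrite (core_sym symA dcgiG).
have cG := core_comm symA dcgiG; have oG := core_outer symA dcgiG.
have [X [Y eG]] := dual_mx_decomp G.
move: symA dcgiG; rewrite dual_mx_tr => /dual_mx_inj[sA _].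
rewrite /is_dcgi /core_equations eG !(dual_mx_mul, dual_mx_tr).
(* The real parts of the dual equations say that [X] solves the core equations of [A]. *)
case=> /dual_mx_inj[AXA _] /dual_mx_inj[AX2 _] /dual_mx_inj[sAX _].
have cX : core_equations A X by split.
move: cG oG; rewrite eG !dual_mx_mul.
move=> /dual_mx_inj[XA eC] /dual_mx_inj[XAX eY].
exists X; split; first split.
- by split; first exact: core_rank cX.
- by move=> X' [_ cX']; apply: core_uniq sA cX cX'.
- by [].
congr dual_mx; apply: dual_core_eps => //.
  by rewrite -eC addrC.
by rewrite -[LHS]eY mulmxDl XA !mulmxA addrC [in LHS](addrC (X *m B *m X)).
Qed.
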